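(* Let $a<b$ be real numbers and let $g:[a,b]\to\mathbb{R}$ be an absolutely continuous function with $0\le g'(t)\le b-a$ for almost every $t\in[a,b]$, and such that $t\mapsto (x-t)g'(t)$ is integrable on $[a,b]$ for every $x\in[a,b]$. Put $\lambda=\frac{g(b)-g(a)}{b-a}$. Then for all $x\in[a,b]$, $$\left|\frac{1}{b-a}\int_a^b g(t)\,dt-\frac{(x-a)g(a)+(b-x)g(b)}{b-a}-\lambda\left(x-\frac{a+b}{2}\right)\right|\le\frac{\lambda}{2}\,(b-a-\lambda)\le\frac{(b-a)^2}{8}.$$ Equality holds in the first inequality when $[a,b]=[0,1]$ and $g(t)=t$. In particular, for $x=\frac{a+b}{2}$, $$\left|\frac{1}{b-a}\int_a^b g(t)\,dt-\frac{g(a)+g(b)}{2}\right|\le\frac{\lambda}{2}\,(b-a-\lambda)\le\frac{(b-a)^2}{8}.$$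
   Context: An absolutely continuous function is differentiable almost everywhere; $g'$ denotes its almost-everywhere derivative, and bounds on $g'$ are understood almost everywhere. *)

(* Defs.v *)
From HB Require Import structures.
From mathcomp Require Import all_boot all_order all_algebra.
From mathcomp Require Import all_classical all_reals all_analysis.

Set Implicit Arguments.
Unset Strict Implicit.
Unset Printing Implicit Defensive.

Import Order.TTheory GRing.Theory Num.Theory.
Import numFieldNormedType.Exports.

Local Open Scope classical_set_scope.
Local Open Scope ring_scope.

(* A function on [a, b] is represented by a total g : R -> R of which only the
   values on [a, b] matter. *)
Definition absolutely_continuous (R : realType) (a b : R) (g : R -> R) : Prop :=
  forall e : R, 0 < e -> exists2 d : R, 0 < d &
    forall (n : nat) (u v : 'I_n -> R),
      (forall i, [/\ a <= u i, u i < v i & v i <= b]) ->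
      trivIset [set: 'I_n] (fun i => `]u i, v i[%classic) ->
      \sum_(i < n) (v i - u i) < d ->
      \sum_(i < n) `|g (v i) - g (u i)| < e.

Definition mean_slope (R : realType) (a b : R) (g : R -> R) : R :=
  (g b - g a) / (b - a).

Definition mean_value (R : realType) (a b : R) (g : R -> R) : R :=
  (b - a)^-1 * \int[lebesgue_measure]_(t in `[a, b]) g t.

Definition ostrowski_dev (R : realType) (a b : R) (g : R -> R) (x : R) : R :=
  `| mean_value a b g
     - ((x - a) * g a + (b - x) * g b) / (b - a)
     - mean_slope a b g * (x - (a + b) / 2) |.

(* Main.v *)
Require Import Defs.
From HB Require Import structures.
From mathcomp Require Import all_boot all_order all_algebra.
From mathcomp Require Import all_classical all_reals all_analysis.
From mathcomp Require Import measurable_realfun ring lra.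

Set Implicit Arguments.
Unset Strict Implicit.
Unset Printing Implicit Defensive.

Import Order.TTheory GRing.Theory Num.Theory.
Import numFieldNormedType.Exports.

Local Open Scope classical_set_scope.
Local Open Scope ring_scope.

(** The deviation does not depend on x, so only the trapezoid estimate at the
    midpoint matters.  Put M = b - a.  If 0 <= g y - g x <= M (y - x) for
    x <= y in [a, b], then g lies below min (g a + M (t - a), g b) and above
    max (g a, g b - M (b - t)); integrating these two piecewise affine
    functions, which break at a + lam and b - lam, gives exactly the bounds
    -+ lam / 2 * (M - lam).

    To get the slope bounds from the bounds on g', write g as the difference of
    two nondecreasing absolutely continuous functions built from its total
    variation.  Their Lebesgue-Stieltjes measures on ]a, b[ are dominated by
    the Lebesgue measure, so by Radon-Nikodym g is the indefinite integral of
    some h, and h = g' almost everywhere by the Lebesgue differentiation theorem.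
    As [derive1] takes a junk value wherever the derivative does not exist,
    almost everywhere differentiability cannot be read off the hypothesis and is
    part of what this argument proves. *)

(** * Absolute continuity and total variation *)

Lemma absolutely_continuous_fin (R : realType) (a b : R) (g : R -> R) (e : R) :
  absolutely_continuous a b g -> 0 < e -> exists2 d : R, 0 < d &
    forall (I : finType) (u v : I -> R),
      (forall i, [/\ a <= u i, u i <= v i & v i <= b]) ->
      (forall i j x, u i < x < v i -> u j < x < v j -> i = j) ->
      \sum_i (v i - u i) < d -> \sum_i `|g (v i) - g (u i)| < e.
Proof.
move=> ac e0; have [d d0 H] := ac e e0; exists d => // I u v uv dis sumd.
pose A := [pred i | u i < v i].
have small (F : I -> R) : (forall i, ~~ (u i < v i) -> F i = 0) ->
    \sum_i F i = \sum_(k < #|A|) F (enum_val k).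
  move=> F0; rewrite (bigID (mem A)) /= addrC big1 ?add0r; first exact: big_enum_val.
  by move=> i /F0.
have uvE i : ~~ (u i < v i) -> u i = v i.
  by have [_ + _] := uv i; rewrite le_eqVlt => /predU1P[->//|->].
rewrite (small (fun i => `|g (v i) - g (u i)|)); last first.
  by move=> i /uvE ->; rewrite subrr normr0.
apply: H.
- by move=> i; have [? _ ?] := uv (enum_val i); split => //; exact: (enum_valP i).
- apply/trivIsetP => i j _ _ /eqP ij; rewrite -subset0 => x [] /=.
  rewrite !in_itv /= => xi xj; apply: ij; apply: enum_val_inj; exact: dis xi xj.
- by rewrite -(small (fun i => v i - u i))// => i /uvE ->; rewrite subrr.
Qed.

Lemma itv_partition_disj (R : realType) (a b : R) (s : seq R) (i j : nat) (x : R) :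
  itv_partition a b s -> (i < size s)%N -> (j < size s)%N ->
  nth b (a :: s) i < x < nth b (a :: s) i.+1 ->
  nth b (a :: s) j < x < nth b (a :: s) j.+1 -> i = j.
Proof.
move=> [srt _].
have nd (k l : nat) : (k <= l)%N -> (l <= size s)%N -> nth b (a :: s) k <= nth b (a :: s) l.
  move=> kl ls; have := @sorted_leq_nth _ <=%R le_trans lexx b (a :: s).
  by apply => //; rewrite ?inE/= ?ltnS ?(leq_trans kl)//; apply: sub_path srt => ? ? /ltW.
wlog ij : i j / (i <= j)%N.
  by move=> W is_ js xi xj; case/orP: (leq_total i j) => ?; [|symmetry]; apply: W.
move=> _ js /andP[_ xi] /andP[xj _]; apply/eqP; rewrite eqn_leq ij /=.
rewrite leqNgt; apply/negP => ji; have := lt_trans xj xi.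
by rewrite ltNge nd// ltnW.
Qed.

(** Serves to pass from a bound valid for every choice of partitions to one on the sum of total
    variations: each supremum is approached up to an equal share of a small [z]. *)
Lemma sum_ereal_sup_le (R : realType) (I : finType) (S : I -> set R) (e : R) :
  (forall i, S i !=set0) ->
  (forall x : I -> R, (forall i, S i (x i)) -> \sum_i x i <= e) ->
  (\sum_i ereal_sup [set x%:E | x in S i] <= e%:E)%E.
Proof.
move=> S0 H; have /choice[w wS] : forall i, exists x, S i x by exact: S0.
have ubS i : has_ubound (S i).
  (* Freezing all coordinates but [i] at the witnesses [w] turns the joint bound into a bound on
     [S i]. *)
  exists (e - \sum_(j | j != i) w j) => x Sx; rewrite lerBrDr.
  have := H (fun j => if j == i then x else w j); rewrite (bigD1 i)//= eqxx.
  under eq_bigr => j /negPf -> do [].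
  by apply=> j; case: eqP => [->|].
under eq_bigr do rewrite ereal_sup_EFin//.
rewrite sumEFin lee_fin; apply/ler_addgt0Pr => z z0.
(* The successor keeps the denominator nonzero when [I] is empty; the shares still add up to at most
   [z]. *)
have n0 : 0 < z / #|I|.+1%:R :> R by rewrite divr_gt0.
have /choice[x xP] : forall i, exists x, S i x /\ sup (S i) - z / #|I|.+1%:R < x.
  by move=> i; have [|x] := @sup_adherent R (S i) _ n0; [split|exists x].
apply: (@le_trans _ _ (\sum_i (x i + z / #|I|.+1%:R))).
  by apply: ler_sum => i _; rewrite -lerBlDr ltW//; case: (xP i).
rewrite big_split/= lerD ?H//; first by move=> i; case: (xP i).
rewrite sumr_const -[X in X <= _]mulr_natr -mulrA ger_pMr// mulrC ler_pdivrMr// mul1r ler_nat.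
by rewrite leqnSn.
Qed.

(** Partitioning each interval yields one finite disjoint family of the same total length, so a
    single [d] controls all the variations at once. Taking suprema weakens [<] to [<=]. *)
Lemma absolutely_continuous_total_variation (R : realType) (a b : R) (g : R -> R) (e : R) :
  absolutely_continuous a b g -> 0 < e -> exists2 d : R, 0 < d &
    forall (I : finType) (u v : I -> R),
      (forall i, [/\ a <= u i, u i <= v i & v i <= b]) ->
      (forall i j x, u i < x < v i -> u j < x < v j -> i = j) ->
      \sum_i (v i - u i) < d ->
      (\sum_i total_variation (u i) (v i) g <= e%:E)%E.
Proof.
move=> ac e0; have [d d0 H] := absolutely_continuous_fin ac e0.
exists d => // I u v uv dis sumd.
have part (s : I -> seq R) : (forall i, itv_partition (u i) (v i) (s i)) ->
    \sum_i variation (u i) (v i) g (s i) < e.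
  move=> sP.
  (* all the partition pieces of all the intervals form one family indexed by J *)
  pose J := {i : I & 'I_(size (s i))}.
  pose p (j : J) := nth (v (tag j)) (u (tag j) :: s (tag j)).
  have sumJ (F : forall i : I, 'I_(size (s i)) -> R) :
      \sum_(j : J) F (tag j) (tagged j) = \sum_i \sum_k F i k.
    by rewrite sig_big_dep.
  have pin (j : J) (k : nat) : (k <= size (s (tag j)))%N -> u (tag j) <= p j k <= v (tag j).
    by move=> ks; rewrite itv_partition_nth_ge// itv_partition_nth_le.
  have ple (j : J) : p j (tagged j) <= p j (tagged j).+1.
    apply: (@nondecreasing_fun_itv_partition _ _ (u (tag j)) (v (tag j)) id) => //.
  have -> : \sum_i variation (u i) (v i) g (s i) =
      \sum_(j : J) `|g (p j (tagged j).+1) - g (p j (tagged j))|.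
    rewrite (sumJ (fun i k => `|g (nth (v i) (u i :: s i) k.+1) - g (nth (v i) (u i :: s i) k)|)).
    by apply: eq_bigr => i _; rewrite /variation big_mkord.
  apply: H.
  - move=> j; have [au _ vb] := uv (tag j); split => //.
    + by apply: le_trans au _; case/andP: (pin j (tagged j) (ltnW (ltn_ord _))).
    + by apply: le_trans vb; case/andP: (pin j (tagged j).+1 (ltn_ord _)).
  - move=> [i k] [i' k'] x /= /andP[xl xr] /andP[xl' xr'].
    have /andP[l1 r1] := pin (existT (fun i : I => 'I_(size (s i))) i k) k (ltnW (ltn_ord _)).
    have /andP[l2 r2] := pin (existT (fun i : I => 'I_(size (s i))) i k) k.+1 (ltn_ord _).
    have /andP[l3 r3] := pin (existT (fun i : I => 'I_(size (s i))) i' k') k' (ltnW (ltn_ord _)).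
    have /andP[l4 r4] := pin (existT (fun i : I => 'I_(size (s i))) i' k') k'.+1 (ltn_ord _).
    (* The point [x] lies in both parent intervals, which therefore coincide; pieces of one
       partition are then told apart by [itv_partition_disj]. *)
    have ii' : i = i'.
      by apply: (dis i i' x); apply/andP; split => /=; [exact: le_lt_trans l1 xl|
        exact: lt_le_trans xr r2|exact: le_lt_trans l3 xl'|exact: lt_le_trans xr' r4].
    subst i'; congr existT; apply: val_inj => /=.
    by apply: (itv_partition_disj (sP i) (ltn_ord k) (ltn_ord k') (x := x)); apply/andP.
  - apply: le_lt_trans sumd.
    rewrite (sumJ (fun i k => nth (v i) (u i :: s i) k.+1 - nth (v i) (u i :: s i) k)).
    apply: ler_sum => i _.
    rewrite -(big_mkord xpredT (fun k => nth (v i) (u i :: s i) k.+1 - nth (v i) (u i :: s i) k)).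
    by rewrite telescope_sumr// (itv_partition_nth_size _ (sP i)).
apply: sum_ereal_sup_le => [i|x xS].
  have [_ + _] := uv i; rewrite le_eqVlt => /predU1P[->|]; last exact: variations_neq0.
  by rewrite variationsxx; exists 0.
have /choice[s sP] : forall i, exists s, itv_partition (u i) (v i) s /\
    variation (u i) (v i) g s = x i by move=> i; have [s] := xS i; exists s.
rewrite (eq_bigr (fun i => variation (u i) (v i) g (s i))); last by move=> i _; rewrite (sP i).2.
by apply/ltW/part => i; exact: (sP i).1.
Qed.

Lemma eq_absolutely_continuous (R : realType) (a b : R) (f g : R -> R) :
  {in `[a, b], f =1 g} -> absolutely_continuous a b f -> absolutely_continuous a b g.
Proof.
move=> fg ac e /ac[d d0 H]; exists d => // n u v uv dis /(H n u v uv dis).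
rewrite (eq_bigr (fun i => `|g (v i) - g (u i)|))// => i _.
have [au /ltW uvi vb] := uv i.
by rewrite !fg// in_itv/= ?au ?vb ?(le_trans uvi)// (le_trans au).
Qed.

Lemma absolutely_continuous_unif (R : realType) (a b : R) (g : R -> R) (e : R) :
  absolutely_continuous a b g -> 0 < e -> exists2 d : R, 0 < d &
    forall x y, x \in `[a, b] -> y \in `[a, b] -> `|x - y| < d -> `|g x - g y| < e.
Proof.
move=> ac e0; have [d d0 H] := absolutely_continuous_fin ac e0; exists d => // x y.
wlog yx : x y / y <= x.
  move=> W xab yab; case/orP: (le_total x y) => xy; last exact: W.
  by rewrite distrC [`|g x - _|]distrC; apply: W.
rewrite !in_itv/= => /andP[ax xb] /andP[ay yb]; rewrite ger0_norm ?subr_ge0// => xyd.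
have := H 'I_1 (fun=> y) (fun=> x); rewrite !big_ord1; apply => //.
by move=> i j; rewrite !ord1.
Qed.

(** Intervals shorter than some [d] have total variation at most 1, and finitely many of them cover
    [[a, b]]. *)
Lemma absolutely_continuous_bounded_variation (R : realType) (a b : R) (g : R -> R) :
  a <= b -> absolutely_continuous a b g -> bounded_variation a b g.
Proof.
move=> ab ac; have [d d0 H] := absolutely_continuous_total_variation ac ltr01.
have H1 u v : a <= u -> u <= v -> v <= b -> v - u < d -> total_variation u v g \is a fin_num.
  move=> au uv vb uvd; rewrite ge0_fin_numE ?total_variation_ge0//.
  apply: le_lt_trans (ltry 1); have := H 'I_1 (fun=> u) (fun=> v).
  rewrite !big_ord1; apply => //.
  by move=> i j; rewrite !ord1.
(* Induction on the number [n] of steps of length [d / 2], short enough for [H1]. *)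
suff fin n x : a <= x -> x <= b -> x <= a + (d / 2) *+ n -> total_variation a x g \is a fin_num.
  apply/(bounded_variationP _ ab)/(fin (Num.bound ((b - a) / (d / 2)))) => //.
  rewrite -lerBlDl -mulr_natr mulrC -ler_pdivrMr ?divr_gt0//.
  by rewrite ltW// archi_boundP// divr_ge0 ?divr_ge0 ?subr_ge0// ltW.
elim: n x => [|n IH] x ax xb xn.
  have -> : x = a by apply/eqP; rewrite eq_le ax -(addr0 a) xn.
  by rewrite total_variationxx.
have [xa|xa] := leP (x - d / 2) a.
  by apply: H1 => //; lra.
rewrite (@total_variationD _ _ _ (x - d / 2)) ?(ltW xa)//; last by lra.
rewrite fin_numD IH ?(ltW xa)//=; [apply: H1; lra|lra|].
by move: xn; rewrite mulrS; lra.
Qed.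

(** By additivity, the increment of the variation function over [[u, v]] is the total variation
    there. Finiteness matters, since [fine] sends infinite values to 0. *)
Lemma absolutely_continuous_fine_total_variation (R : realType) (a b : R) (g : R -> R) :
  a <= b -> absolutely_continuous a b g ->
  absolutely_continuous a b (fun x => fine (total_variation a x g)).
Proof.
move=> ab ac e e0; have e20 : 0 < e / 2 by rewrite divr_gt0.
have bv := absolutely_continuous_bounded_variation ab ac.
have [d d0 H] := absolutely_continuous_total_variation ac e20.
exists d => // n u v uv dis sd.
apply: le_lt_trans (_ : e / 2 < e); last by lra.
rewrite -lee_fin -sumEFin; have := H 'I_n u v; rewrite (eq_bigr (fun i =>
  (`|fine (total_variation a (v i) g) - fine (total_variation a (u i) g)|)%:E)).
  apply => //; first by move=> i; have [? /ltW] := uv i.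
  move=> i j x xi xj; move/trivIsetP : dis => /(_ i j I I) D.
  apply/eqP/negP => /negP /D; rewrite -subset0 => /(_ x); apply.
  by split => /=; rewrite in_itv.
move=> i _; have [au /ltW uvi vb] := uv i.
have av := le_trans au uvi.
have vfin : total_variation a (v i) g \is a fin_num.
  exact/bounded_variationP/(bounded_variationl av vb bv).
have := total_variationD g au uvi => E.
move: vfin; rewrite E fin_numD => /andP[ufin uvfin].
by rewrite fineD// addrAC subrr add0r ger0_norm ?fine_ge0 ?total_variation_ge0// fineK.
Qed.

(** * Decomposition into monotone absolutely continuous functions *)

(** Stieltjes measures require a monotone right-continuous function on the whole line. Precomposing
    with the clamp [p] onto [[a, b]], which is monotone and 1-Lipschitz, provides one. *)
Lemma cumulative_extension (R : realType) (a b : R) (F : R -> R) : a <= b ->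
  absolutely_continuous a b F -> {in `[a, b] &, nondecreasing_fun F} ->
  exists G : cumulative R R, {in `[a, b], G =1 F}.
Proof.
move=> ab ac ndF; pose p x := Num.max a (Num.min x b).
have pab x : p x \in `[a, b].
  by rewrite in_itv/= le_max lexx ge_max ab/= ge_min lexx orbT.
have pE x : x \in `[a, b] -> p x = x.
  by rewrite in_itv/= => /andP[ax xb]; rewrite /p (min_idPl xb) (max_idPr ax).
have pnd : {homo p : x y / x <= y}.
  by move=> x y xy; rewrite /p ge_max le_max lexx/= le_max ge_min;
     case: (leP x b) => xb; rewrite ?le_min ?xb ?xy ?lexx ?orbT//= (le_trans _ xy) ?orbT// ltW.
have plip x y : x <= y -> p y - p x <= y - x.
  rewrite /p /Num.max /Num.min; do ! case: ifPn => //; rewrite -?leNgt; lra.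
have G_nd : nondecreasing (F \o p) by move=> x y /pnd; apply: ndF.
have G_rc : right_continuous (F \o p).
  move=> x; apply/cvgrPdist_lt => e e0.
  have [d d0 H] := absolutely_continuous_unif ac e0.
  near=> y => /=; apply: H => //.
  have xy : x <= y by near: y; exact: nbhs_right_ge.
  rewrite distrC ger0_norm ?subr_ge0 ?pnd// (le_lt_trans (plip _ _ xy))// ltrBlDl.
  by near: y; apply: nbhs_right_lt; rewrite ltrDl.
pose G := HB.pack_for (cumulative R R) (F \o p) (isCumulative.Build R _ R (F \o p) G_nd G_rc).
by exists G => x /pE /= ->.
Unshelve. all: by end_near. Qed.

(** The decomposition is [g = V - (V - g)] with [V] the variation function. Increments of [V]
    dominate those of [g] in absolute value, which makes both terms nondecreasing. *)
Lemma absolutely_continuous_jordan (R : realType) (a b : R) (g : R -> R) :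
  a <= b -> absolutely_continuous a b g -> exists F1 F2 : cumulative R R,
  [/\ absolutely_continuous a b F1, absolutely_continuous a b F2 &
      {in `[a, b], g =1 F1 \- F2}].
Proof.
move=> ab ac; pose V x := fine (total_variation a x g).
have acV : absolutely_continuous a b V by exact: absolutely_continuous_fine_total_variation.
have bv := absolutely_continuous_bounded_variation ab ac.
have V_ge x y : x \in `[a, b] -> y \in `[a, b] -> x <= y -> `|g y - g x| <= V y - V x.
  rewrite !in_itv/= => /andP[ax xb] /andP[ay yb] xy.
  have vfin : total_variation a y g \is a fin_num.
    exact/bounded_variationP/(bounded_variationl ay yb bv).
  have E := total_variationD g ax xy.
  move: vfin; rewrite E fin_numD => /andP[ufin uvfin].
  rewrite /V E fineD// addrAC subrr add0r -lee_fin fineK//.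
  exact: total_variation_ge.
have acW : absolutely_continuous a b (V \- g).
  move=> e e0; have e20 : 0 < e / 2 by rewrite divr_gt0.
  have [d d0 H] := acV _ e20; exists d => // n u v uv dis /(H n u v uv dis) lt.
  (* An increment of [V - g] is at most one of [V] plus one of [g], hence at most twice that of
     [V]. *)
  apply: (@le_lt_trans _ _ (\sum_(i < n) 2 * `|V (v i) - V (u i)|)); last first.
    by rewrite -mulr_sumr mulrC -ltr_pdivlMr.
  apply: ler_sum => i _; have [au /ltW uvi vb] := uv i.
  have := V_ge (u i) (v i); rewrite !in_itv/= au vb (le_trans uvi vb) (le_trans au uvi).
  move=> /(_ isT isT uvi) gV.
  have -> : (V \- g) (v i) - (V \- g) (u i) = (V (v i) - V (u i)) - (g (v i) - g (u i)).
    by rewrite /=; ring.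
  apply: le_trans (ler_normB _ _) _; rewrite mulrDl mul1r lerD2l.
  exact: le_trans gV (ler_norm _).
have ndV : {in `[a, b] &, nondecreasing_fun V}.
  by move=> x y xab yab xy; rewrite -subr_ge0 (le_trans _ (V_ge _ _ xab yab xy)).
have ndW : {in `[a, b] &, nondecreasing_fun (V \- g)}.
  move=> x y xab yab xy /=; have := V_ge _ _ xab yab xy.
  by have := ler_norm (g y - g x); lra.
have [F1 F1E] := cumulative_extension ab acV ndV.
have [F2 F2E] := cumulative_extension ab acW ndW.
exists F1, F2; split.
- by apply: eq_absolutely_continuous acV => x xab; rewrite F1E.
- by apply: eq_absolutely_continuous acW => x xab; rewrite F2E.
- by move=> x xab /=; rewrite F1E// F2E//= opprB addrC subrK.
Qed.

(** * Stieltjes measures and their densities *)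

Lemma lebesgue_stieltjes_measure_itvoc (R : realType) (F : cumulative R R) (x y : R) :
  x <= y -> lebesgue_stieltjes_measure F `]x, y]%classic = (F y - F x)%:E.
Proof.
move=> xy; rewrite /lebesgue_stieltjes_measure /measure_extension.
by rewrite measurable_mu_extE/=; [exact: wlength_itv_bnd|exact: is_ocitv].
Qed.

(** Gives the components of an open set the endpoints to which absolute continuity applies. *)
Lemma open_interval_itvoo (R : realType) (a b : R) (J : set R) : a <= b ->
  open J -> is_interval J -> J `<=` `]a, b[ ->
  exists p : R * R, [/\ a <= p.1, p.1 <= p.2, p.2 <= b & J = `]p.1, p.2[%classic].
Proof.
move=> ab oJ iJ Jab; have [->|/set0P[x Jx]] := eqVneq J set0.
  (* The empty set is represented as []a, a[]. *)
  by exists (a, a); split => //=; rewrite set_itv_ge// bnd_simp ltxx.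
have lbJ : lbound J a by move=> y /Jab /=; rewrite in_itv/= => /andP[/ltW].
have ubJ : ubound J b by move=> y /Jab /=; rewrite in_itv/= => /andP[_ /ltW].
have JE : J = `]inf J, sup J[%classic.
  rewrite -[LHS]((interior_id J).1 oJ) interval_bounded_interior//; last 2 first.
  - by exists a.
  - by exists b.
exists (inf J, sup J); split => //=.
- by apply: lb_le_inf => //; exists x.
- by move: Jx; rewrite {1}JE /= in_itv/= => /andP[l r]; apply/ltW/(lt_trans l r).
- by apply: ge_sup => //; exists x.
Qed.

(** Cover [N] by an open [U] of measure below [d] and split its trace on []a, b[] into countably
    many disjoint open intervals. Any finitely many of them have total length below [d], so absolute
    continuity bounds their increments by [e]. *)
Lemma lebesgue_stieltjes_measure_null (R : realType) (a b : R) (F : cumulative R R)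
    (N : set (measurableTypeR R)) :
  a <= b -> absolutely_continuous a b F -> measurable N ->
  lebesgue_measure N = 0%E -> lebesgue_stieltjes_measure F (N `&` `]a, b[) = 0%E.
Proof.
move=> ab ac mN N0; apply/eqP; rewrite eq_le measure_ge0 andbT.
apply/lee_addgt0Pr => e e0; rewrite add0e.
have [d d0 H] := absolutely_continuous_fin ac e0.
have Ny : (lebesgue_measure N < +oo)%E by rewrite N0 ltry.
have [U [oU NU UN]] := lebesgue_regularity_outer mN Ny d0.
have mU : measurable U by exact: open_measurable.
have Ud : (lebesgue_measure U < d%:E)%E.
  apply: (@le_lt_trans _ _ (lebesgue_measure N + lebesgue_measure (U `\` N))%E).
    by rewrite -{1}(setDUK NU); apply: measureU2 => //; exact: measurableD.
  by rewrite N0 add0e.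
have oW : open (U `&` `]a, b[%classic) by apply: openI => //; exact: interval_open.
pose J := open_disjoint_itv oW.
have JE : U `&` `]a, b[%classic = \bigcup_q J q by exact: open_disjoint_itv_bigcup.
have mJ q : measurable (J q : set (measurableTypeR R)).
  by apply: open_measurable; exact: open_disjoint_itv_open.
have tJ : trivIset setT J by exact: open_disjoint_itv_trivIset.
have /choice[p pP] : forall q, exists p : R * R,
    [/\ a <= p.1, p.1 <= p.2, p.2 <= b & J q = `]p.1, p.2[%classic].
  move=> q; apply: open_interval_itvoo => //; first exact: open_disjoint_itv_open.
    exact: open_disjoint_itv_is_interval.
  by move=> x Jx; have : (\bigcup_q J q) x by [exists q]; rewrite -JE => -[].
have mI : measurable (`]a, b[%classic : set (measurableTypeR R)) by exact: measurable_itv.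
have mNI : measurable (N `&` `]a, b[%classic : set (measurableTypeR R)) by exact: measurableI.
have mUJ : measurable (\bigcup_q J q : set (measurableTypeR R)) by exact: bigcup_measurable.
apply: (@le_trans _ _ (lebesgue_stieltjes_measure F (\bigcup_q J q))).
  apply: le_measure; rewrite ?inE//.
  by rewrite -JE; apply: setSI.
(* The measure of the union is a limit of partial sums, so bounding each finite sum suffices. *)
rewrite measure_bigcup//; apply: lime_le.
  by apply: is_cvg_nneseries => *; exact: measure_ge0.
apply: nearW => n.
have sumd : \sum_(q < n) ((p q).2 - (p q).1) < d.
  rewrite -lte_fin -sumEFin; apply: le_lt_trans Ud.
  apply: (@le_trans _ _ (lebesgue_measure (\bigcup_q J q))); last first.
    apply: le_measure; rewrite ?inE//.
    by rewrite -JE; exact: subIsetl.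
  rewrite measure_bigcup//.
  rewrite (eq_bigr (fun q : 'I_n => lebesgue_measure (J q))).
    rewrite -(big_mkord xpredT (fun q => lebesgue_measure (J q))).
    rewrite (eq_eseriesl (Q := xpredT)); last by move=> q; rewrite in_setT.
    by apply: nneseries_lim_ge => q _ _; exact: measure_ge0.
  move=> q _; have [_ pq _ ->] := pP q; rewrite lebesgue_measure_itv/= lte_fin.
  by move: pq; rewrite le_eqVlt => /predU1P[->|->]; rewrite ?ltxx ?subrr// EFinB.
apply: (@le_trans _ _ (\sum_(q < n) `|F (p q).2 - F (p q).1|)%:E); last first.
  rewrite lee_fin ltW//; apply: H => //; first by move=> q; have [] := pP q.
  move=> i j x xi xj; apply: val_inj => /=; apply: contrapT => /eqP ij.
  move/trivIsetP : tJ => /(_ i j I I ij); rewrite -subset0 => /(_ x); apply.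
  have [_ _ _ ->] := pP i; have [_ _ _ ->] := pP j.
  by split; rewrite /= in_itv.
rewrite -sumEFin big_mkord.
rewrite (eq_bigl xpredT); last by move=> q; rewrite in_setT.
apply: lee_sum => q _; have [_ pq _ ->] := pP q.
(* The increment of [F] is the measure of the half-open interval, which contains the open one. *)
rewrite ger0_norm ?subr_ge0 ?cumulative_is_nondecreasing//.
rewrite -lebesgue_stieltjes_measure_itvoc//; apply: le_measure; rewrite ?inE//.
exact: subset_itv_oo_oc.
Qed.

(** Radon-Nikodym applied to the Stieltjes measure restricted to []a, b[], which is finite. The
    condition [y < b] places []x, y]] inside that open interval. *)
Lemma absolutely_continuous_density (R : realType) (a b : R) (F : cumulative R R) :
  a < b -> absolutely_continuous a b F ->
  exists f : R -> R, lebesgue_measure.-integrable setT (EFin \o f) /\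
    forall x y, a <= x -> x <= y -> y < b ->
      F y - F x = \int[lebesgue_measure]_(t in `]x, y]) f t.
Proof.
move=> ab ac; have mI : measurable (`]a, b[%classic : set (measurableTypeR R)).
  exact: measurable_itv.
have Ioo : (lebesgue_stieltjes_measure F `]a, b[%classic < +oo)%E.
  apply: (@le_lt_trans _ _ (lebesgue_stieltjes_measure F `]a, b]%classic)).
    by apply: le_measure; rewrite ?inE//; exact: subset_itv_oo_oc.
  by rewrite lebesgue_stieltjes_measure_itvoc ?ltW// ltry.
pose nu := mfrestr mI Ioo.
have nuE A : nu A = lebesgue_stieltjes_measure F (A `&` `]a, b[%classic) by [].
have dom : nu `<< lebesgue_measure.
  move=> N N0 A mA AN; rewrite nuE lebesgue_stieltjes_measure_null//; first exact: ltW.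
  exact: N0.
have [f [_ ffin fint fE]] := radon_nikodym_sigma_finite dom.
exists (fine \o f); split.
  by apply: eq_integrable fint => // x _; rewrite /= fineK.
move=> x y ax xy yb; rewrite /Rintegral.
under eq_integral => t _ do rewrite /= fineK//.
have -> : (\int[lebesgue_measure]_(t in `]x, y]) f t = nu `]x, y]%classic)%E.
  exact (esym (fE _ (measurable_itv `]x, y]))).
rewrite nuE (_ : _ `&` _ = `]x, y]%classic) ?lebesgue_stieltjes_measure_itvoc//.
apply/setIidPl => t /=; rewrite !in_itv/= => /andP[xt ty].
by rewrite (le_lt_trans ax xt) (le_lt_trans ty yb).
Qed.

(** * From almost everywhere bounds on the derivative to slope bounds *)

(** On [D] the function agrees almost everywhere with its absolute value. *)
Lemma ae_Rintegral_ge0 (d : measure_display) (T : measurableType d) (R : realType)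
    (mu : {measure set T -> \bar R}) (D : set T) (f : T -> R) :
  measurable D -> measurable_fun D f -> {ae mu, forall x, D x -> 0 <= f x} ->
  0 <= \int[mu]_(x in D) f x.
Proof.
move=> mD mf f0; have -> : \int[mu]_(x in D) f x = \int[mu]_(x in D) `|f x|.
  congr fine; apply: ae_eq_integral => //.
  - exact/measurable_EFinP.
  - by apply/measurable_EFinP; apply: measurableT_comp.
  - by apply: filterS f0 => x f0 Dx; rewrite ger0_norm ?f0.
by apply: Rintegral_ge0.
Qed.

Lemma lebesgue_integrable_cst_itv (R : realType) (x y M : R) :
  lebesgue_measure.-integrable `]x, y] (EFin \o cst M).
Proof.
have xyoo : (lebesgue_measure (`]x, y]%classic : set (measurableTypeR R)) < +oo)%E.
  by rewrite lebesgue_measure_itv/=; case: ifP => _; rewrite -?EFinB ltry.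
apply: measurable_bounded_integrable => //.
by exists `|M|; split; rewrite ?num_real// => e Me t _; exact: ltW.
Qed.

Lemma lebesgue_Rintegral_cst_itv (R : realType) (x y M : R) : x <= y ->
  \int[lebesgue_measure]_(t in `]x, y]) M = M * (y - x).
Proof.
move=> xy; rewrite (_ : \int[_]_(_ in _) _ =
    M * fine (lebesgue_measure (`]x, y]%classic : set (measurableTypeR R)))).
  rewrite lebesgue_measure_itv/= lte_fin.
  by move: xy; rewrite le_eqVlt => /predU1P[->|->]; rewrite ?ltxx ?subrr.
exact: Rintegral_cst.
Qed.

(** Lebesgue differentiation handles the indefinite integral [F] of [h]; near each point of []a, b[]
    the function [g] is [F] plus the constant [g a]. *)
Lemma derive1_of_integral (R : realType) (a b : R) (g h : R -> R) :
  lebesgue_measure.-integrable setT (EFin \o h) ->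
  (forall x, a <= x -> x < b -> g x - g a = \int[lebesgue_measure]_(t in `]a, x]) h t) ->
  {ae lebesgue_measure, forall x, a < x < b -> derive1 g x = h x}.
Proof.
move=> hint gE.
have hint' y : lebesgue_measure.-integrable [set` Interval (BRight a) (BRight y)] (EFin \o h).
  exact: integrableS hint.
have := FTC1 hint' (open_integrable_locally openT hint).
apply: filterS; first exact: (ae_filter_ringOfSetsType lebesgue_measure).
move=> x /= + /andP[ax xb]; rewrite lte_fin => /(_ ax)[dF <-].
set F := (fun y => _) in dF *.
rewrite !derive1E (@near_eq_derive _ _ _ g (cst (g a) + F)).
  by rewrite deriveD// derive_cst add0r.
near=> z; have -> : (cst (g a) + F) z = g a + F z by [].
have <- : g z - g a = F z.
  apply: gE; first by apply: ltW; near: z; exact: lt_nbhsr.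
  by near: z; exact: lt_nbhsl.
by rewrite addrC subrK.
Unshelve. all: by end_near. Qed.

Lemma absolutely_continuous_slope (R : realType) (a b M : R) (g : R -> R) :
  a < b -> absolutely_continuous a b g ->
  {ae lebesgue_measure, forall t : R, t \in `[a, b] ->
     0 <= derive1 g t /\ derive1 g t <= M} ->
  forall x y, a <= x -> x <= y -> y <= b -> 0 <= g y - g x <= M * (y - x).
Proof.
move=> ab ac dg.
have [F1 [F2 [ac1 ac2 gF]]] := absolutely_continuous_jordan (ltW ab) ac.
have [f1 [int1 F1E]] := absolutely_continuous_density ab ac1.
have [f2 [int2 F2E]] := absolutely_continuous_density ab ac2.
pose h t := f1 t - f2 t.
have hint : lebesgue_measure.-integrable setT (EFin \o h).
  by apply: eq_integrable (integrableB measurableT int1 int2) => //.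
have hintS (D : set (measurableTypeR R)) : measurable D ->
  lebesgue_measure.-integrable D (EFin \o h) by move=> mD; exact: integrableS hint.
have gE x y : a <= x -> x <= y -> y < b ->
    g y - g x = \int[lebesgue_measure]_(t in `]x, y]) h t.
  move=> ax xy yb; rewrite !gF ?in_itv/= ?ax ?(le_trans ax xy) ?ltW ?(le_lt_trans xy yb)//.
  rewrite RintegralB//; last 2 first.
    - exact: integrableS int1.
    - exact: integrableS int2.
  by rewrite -F1E// -F2E//; ring.
have hM : {ae lebesgue_measure, forall t, a < t < b -> 0 <= h t <= M}.
  have := derive1_of_integral hint (fun x ax xb => gE a x (lexx a) ax xb).
  apply: filterS2 dg; first exact: (ae_filter_ringOfSetsType lebesgue_measure).
  move=> t dg hE /[dup] abt /hE <-; apply/andP/dg.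
  by case/andP: abt => /ltW at_ /ltW tb; rewrite in_itv/= at_.
have slope x y : a <= x -> x <= y -> y < b -> 0 <= g y - g x <= M * (y - x).
  move=> ax xy yb; rewrite gE//.
  have mI : measurable (`]x, y]%classic : set (measurableTypeR R)) by exact: measurable_itv.
  have mh : measurable_fun (`]x, y]%classic : set (measurableTypeR R)) h.
    by have /integrableP[/measurable_EFinP] := hintS _ mI.
  have sub t : `]x, y]%classic t -> a < t < b.
    by rewrite /= in_itv/= => /andP[xt ty]; rewrite (le_lt_trans ax xt) (le_lt_trans ty yb).
  apply/andP; split.
    apply: ae_Rintegral_ge0 => //; apply: filterS hM; last by move=> t ht /sub/ht/andP[].
    exact: (ae_filter_ringOfSetsType lebesgue_measure).
  have -> : M * (y - x) = \int[lebesgue_measure]_(t in `]x, y]) M.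
    by rewrite lebesgue_Rintegral_cst_itv.
  (* The upper bound is nonnegativity of the integral of [M - h]. *)
  rewrite -subr_ge0 -RintegralB//; last 2 first.
    - exact: lebesgue_integrable_cst_itv.
    - exact: hintS.
  apply: ae_Rintegral_ge0 => //; first by apply: measurable_funB.
  apply: filterS hM; last by move=> t ht /sub/ht/andP[_]; rewrite subr_ge0.
  exact: (ae_filter_ringOfSetsType lebesgue_measure).
move=> x y ax xy; rewrite le_eqVlt => /predU1P[yb|]; last exact: slope.
move: xy; rewrite le_eqVlt => /predU1P[->|xb]; first by rewrite !subrr mulr0 lexx.
(* The integral formula stops short of [b]; the endpoint is reached by continuity, through points
   [z < b] where [g] is close to [g b]. *)
have close e : 0 < e -> exists2 z, x <= z < b & `|g b - g z| < e.
  move=> e0; have [d d0 H] := absolutely_continuous_unif ac e0.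
  exists (Num.max x (b - d / 2)).
    by rewrite le_max lexx gt_max -yb xb ltrBlDr ltrDl divr_gt0.
  apply: H; rewrite ?in_itv/= ?(ltW ab) ?lexx//.
    by rewrite le_max ax ge_max -yb (ltW xb) lerBlDr lerDl divr_ge0// ltW.
  rewrite ger0_norm ?subr_ge0 ?ge_max -?yb ?(ltW xb) ?lerBlDr ?lerDl ?divr_ge0 ?(ltW d0)//.
  by rewrite ltrBlDr -ltrBlDl lt_max; apply/orP; right; lra.
(* The sign of [M] follows from the slope bounds on a nondegenerate interval; it gives
   [M * (z - x) <= M * (b - x)] below. *)
have M0 : 0 <= M.
  have zb : x < (x + b) / 2 < b by apply/andP; split; lra.
  have := slope x ((x + b) / 2); case/andP: zb => zb1 zb2 /(_ ax (ltW zb1) zb2)/andP[s1 s2].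
  by have := le_trans s1 s2; rewrite pmulr_lge0 ?subr_gt0.
rewrite yb; apply/andP; split; apply/ler_addgt0Pr => e /close[z /andP[xz zb]].
  by have /andP[+ _] := slope x z ax xz zb; rewrite ltr_distlC => ? /andP[]; lra.
have /andP[_ s] := slope x z ax xz zb; rewrite ltr_distlC => /andP[z1 z2].
have : M * (z - x) <= M * (b - x) by rewrite ler_wpM2l// lerD2r ltW.
by lra.
Qed.

(** * Piecewise affine bounds and the trapezoid estimate *)

Lemma Rintegral_affine (R : realType) (c d p q : R) : c <= d ->
  lebesgue_measure.-integrable `[c, d] (EFin \o (fun t => p + q * t)) /\
  \int[lebesgue_measure]_(t in `[c, d]) (p + q * t) = p * (d - c) + q * (d ^+ 2 - c ^+ 2) / 2.
Proof.
move=> cd; pose P t : R := p * t + q * t ^+ 2 / 2.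
have cf : continuous (fun t : R => p + q * t).
  by move=> t; apply: cvgD; [exact: cvg_cst|apply: cvgM; [exact: cvg_cst|exact: cvg_id]].
have dP (t : R) : is_derive t 1 P (p + q * t).
  rewrite /P; apply: is_derive_eq. rewrite /GRing.scale /=. by field.
have cP : continuous P by move=> t; exact/differentiable_continuous/derivable1_diffP/ex_derive.
split.
  apply: continuous_compact_integrable; first exact: segment_compact.
  exact: continuous_subspaceT.
(* The one-point interval is treated apart; it occurs when a breakpoint falls on an endpoint of
   [[a, b]]. *)
move: cd; rewrite le_eqVlt => /predU1P[->|cd].
  by rewrite set_itv1 Rintegral_set1 !subrr; ring.
rewrite /Rintegral (continuous_FTC2 (F := P))//.
- by rewrite /P /=; field.
- exact: continuous_subspaceT.
- split.
  + by move=> t _; exact: ex_derive.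
  + by apply: cvg_at_right_filter; exact: cP.
  + by apply: cvg_at_left_filter; exact: cP.
- by move=> t _; rewrite derive1E derive_val.
Qed.

Lemma absolutely_continuous_within (R : realType) (a b : R) (g : R -> R) :
  absolutely_continuous a b g -> {within `[a, b], continuous g}.
Proof.
move=> ac; apply/subspace_continuousP => x xab; apply/cvgrPdist_lt => e e0.
have [d d0 H] := absolutely_continuous_unif ac e0.
rewrite near_withinE; near=> y => yab; apply: H => //.
Unshelve. all: by end_near. Qed.

Lemma Rintegral_le_affine2 (R : realType) (a c b p1 q1 p2 q2 : R) (g : R -> R) :
  a <= c -> c <= b -> lebesgue_measure.-integrable `[a, b] (EFin \o g) ->
  (forall t, a <= t <= c -> g t <= p1 + q1 * t) ->
  (forall t, c <= t <= b -> g t <= p2 + q2 * t) ->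
  \int[lebesgue_measure]_(t in `[a, b]) g t <=
    p1 * (c - a) + q1 * (c ^+ 2 - a ^+ 2) / 2 + (p2 * (b - c) + q2 * (b ^+ 2 - c ^+ 2) / 2).
Proof.
move=> ac cb gi g1 g2.
have [i1 E1] := Rintegral_affine p1 q1 ac; have [i2 E2] := Rintegral_affine p2 q2 cb.
have gc : lebesgue_measure.-integrable `[c, b] (EFin \o g).
  by apply: integrableS gi => //; apply: subset_itvr; rewrite bnd_simp.
(* Split the integral at the breakpoint [c], then close the left end of []c, b]], a single point
   being negligible. *)
rewrite -(subrK (\int[lebesgue_measure]_(t in `[a, c]) g t)
                (\int[lebesgue_measure]_(t in `[a, b]) g t)).
rewrite Rintegral_itvB ?bnd_simp//.
rewrite Rintegral_itv_obnd_cbnd; last first.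
  by apply: integrableS gc => //; exact: subset_itv_oc_cc.
rewrite addrC -E1 -E2; apply: lerD; apply: le_Rintegral => //.
by apply: integrableS gi => //; apply: subset_itvl; rewrite bnd_simp.
Qed.

Lemma mean_value_trapezoid (R : realType) (a b : R) (g : R -> R) :
  a < b -> {within `[a, b], continuous g} ->
  (forall x y, a <= x -> x <= y -> y <= b -> 0 <= g y - g x <= (b - a) * (y - x)) ->
  `| mean_value a b g - (g a + g b) / 2 | <=
    mean_slope a b g / 2 * (b - a - mean_slope a b g).
Proof.
move=> ab cg slope; set l := mean_slope a b g.
have ba0 : 0 < b - a by rewrite subr_gt0.
have gi : lebesgue_measure.-integrable `[a, b] (EFin \o g).
  by apply: continuous_compact_integrable => //; exact: segment_compact.
have lE : g b = g a + l * (b - a) by rewrite /l /mean_slope divfK ?gt_eqF// subrKC.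
have /andP[l0 l1] : 0 <= l <= b - a.
  have /andP[s1 s2] := slope a b (lexx _) (ltW ab) (lexx _).
  by rewrite /l /mean_slope ler_pdivrMr// divr_ge0// ltW.
have gle t : a <= t -> t <= b -> [/\ g a <= g t, g t <= g b,
    g t <= g a + (b - a) * (t - a) & g b - (b - a) * (b - t) <= g t].
  move=> at_ tb; have /andP[s1 s2] := slope a t (lexx _) at_ tb.
  by have /andP[s3 s4] := slope t b at_ tb (lexx _); split; lra.
have up : \int[lebesgue_measure]_(t in `[a, b]) g t <=
    (b - a) * ((g a + g b) / 2 + l / 2 * (b - a - l)).
  (* The line of slope [b - a] through [(a, g a)] reaches the height [g b] at [a + l], because
     [g b - g a = l * (b - a)]. *)
  apply: le_trans (@Rintegral_le_affine2 R a (a + l) b (g a - (b - a) * a) (b - a) (g b) 0 g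
    _ _ gi _ _) _.
  - by lra.
  - by lra.
  - by move=> t /andP[at_ tl]; have [] := gle t at_ _; lra.
  - by move=> t /andP[at_ tl]; have [] := gle t _ tl; lra.
  - by rewrite lE le_eqVlt; apply/orP; left; apply/eqP; field.
have gNi : lebesgue_measure.-integrable `[a, b] (EFin \o \- g).
  by apply: eq_integrable (integrableN gi).
have lo : (b - a) * ((g a + g b) / 2 - l / 2 * (b - a - l)) <=
    \int[lebesgue_measure]_(t in `[a, b]) g t.
  rewrite -lerN2 (_ : - (\int[lebesgue_measure]_(t in `[a, b]) g t) =
      \int[lebesgue_measure]_(t in `[a, b]) (\- g) t).
    (* The lower bound is an upper bound for [- g]: the line of slope [b - a] through [(b, g b)] has
       height [g a] at [b - l]. *)
    apply: le_trans (@Rintegral_le_affine2 R a (b - l) b (- g a) 0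
      (- g b + (b - a) * b) (a - b) (\- g) _ _ gNi _ _) _.
    - by lra.
    - by lra.
    - by move=> t /= /andP[at_ tl]; have [] := gle t at_ _; lra.
    - by move=> t /= /andP[at_ tl]; have [] := gle t _ tl; lra.
    - by rewrite lE le_eqVlt; apply/orP; left; apply/eqP; field.
  rewrite -mulN1r -RintegralZl//.
  by apply: eq_Rintegral => t _; rewrite mulN1r.
rewrite /mean_value ler_distl; apply/andP; split.
- by rewrite ler_pdivlMl.
- by rewrite ler_pdivrMl.
Qed.

(** * Independence of [x], the final inequalities and the equality case *)

(** The weighted endpoint term has [x]-coefficient [- mean_slope a b g], which cancels against the
    correction term, so the value is that at the midpoint. *)
Lemma ostrowski_dev_midpoint (R : realType) (a b x : R) (g : R -> R) : a < b ->
  ostrowski_dev a b g x = `| mean_value a b g - (g a + g b) / 2 |.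
Proof.
move=> ab; rewrite /ostrowski_dev; congr `| _ |; rewrite /mean_slope; field.
by rewrite subr_eq0 gt_eqF.
Qed.

Theorem theorem3 (R : realType) :
  (forall (a b : R) (g : R -> R),
     a < b ->
     absolutely_continuous a b g ->
     {ae lebesgue_measure, forall t : R, t \in `[a, b] ->
        0 <= derive1 g t /\ derive1 g t <= b - a} ->
     (forall x : R, x \in `[a, b] ->
        lebesgue_measure.-integrable `[a, b]
          (fun t : R => ((x - t) * derive1 g t)%:E)) ->
     let lam := mean_slope a b g in
     (forall x : R, x \in `[a, b] ->
        ostrowski_dev a b g x <= lam / 2 * (b - a - lam) /\
        lam / 2 * (b - a - lam) <= (b - a) ^+ 2 / 8) /\
     (`| mean_value a b g - (g a + g b) / 2 | <= lam / 2 * (b - a - lam) /\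
      lam / 2 * (b - a - lam) <= (b - a) ^+ 2 / 8)) /\
  (forall g : R -> R,
     (forall t : R, t \in `[0, 1] -> g t = t) ->
     let lam := mean_slope 0 1 g in
     forall x : R, x \in `[0, 1] ->
       ostrowski_dev 0 1 g x = lam / 2 * (1 - 0 - lam)).
Proof.
split=> [a b g ab ac dg _ lam|g gE lam x _].
  have slope := absolutely_continuous_slope ab ac dg.
  have dev := mean_value_trapezoid ab (absolutely_continuous_within ac) slope.
  have amgm : lam / 2 * (b - a - lam) <= (b - a) ^+ 2 / 8.
    (* The difference of the two sides is [(b - a - 2 * lam) ^+ 2 / 8]. *)
    by have := sqr_ge0 (b - a - 2 * lam); lra.
  by split=> // x _; rewrite ostrowski_dev_midpoint.
have g0 : g 0 = 0 by rewrite gE// in_itv/= lexx ler01.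
have g1 : g 1 = 1 by rewrite gE// in_itv/= lexx ler01.
(* Here [lam = 1 = b - a], so both sides turn out to be 0. *)
rewrite ostrowski_dev_midpoint// /lam /mean_slope /mean_value g0 g1.
have -> : \int[lebesgue_measure]_(t in `[0, 1]) g t =
    \int[lebesgue_measure]_(t in `[0, 1]) (0 + 1 * t).
  by apply: eq_Rintegral => t; rewrite inE/= => /gE ->; rewrite add0r mul1r.
rewrite (Rintegral_affine 0 1 ler01).2.
rewrite (_ : (1 - 0)^-1 * _ - _ = 0) ?normr0; last by field.
by field.
Qed.
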